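(* Let $X(t)$ be the LTD on a network $\mathcal G=(\mathcal V,\mathcal E,W)$ with constant external field $h\in\mathbb R^{\mathcal V}$ and any initial configuration. Then with probability $1$ there exists $t_0\ge0$ such that $X(t)\in\mathcal X^*_h$ for all $t\ge t_0$.
   Context: A network is $\mathcal G=(\mathcal V,\mathcal E,W)$ with finite node set $\mathcal V$, links $\mathcal E\subseteq\mathcal V\times\mathcal V$, weight matrix $W\in\mathbb R_+^{\mathcal V\times\mathcal V}$ with zero diagonal, $W_{ij}>0$ iff $(i,j)\in\mathcal E$. $\mathcal X=\{-1,+1\}^{\mathcal V}$. LTD with constant external field $h$: $X(t)\in\mathcal X$; each agent $i$ has an independent rate-$1$ Poisson clock; when $i$'s clock ticks at time $t$, only $i$ updates, setting $X_i(t)=+1$ if $\sum_jW_{ij}X_j(t^-)+h_i>0$, $X_i(t)=X_i(t^-)$ if $=0$, $X_i(t)=-1$ if $<0$. $\mathcal X^*_h$ is the set of (pure Nash) equilibria of the coordination game on $\mathcal G$ with external field $h$: players $\mathcal V$, actions $\{\pm1\}$, utilities $u_i(x)=x_i(\sum_jW_{ij}x_j+h_i)$; $x^*$ is an equilibrium if for all $i$, $x_i^*$ maximizes $u_i(\cdot,x^*_{-i})$ over $\{\pm1\}$. *)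

(* Defs.v *)
From HB Require Import structures.
From mathcomp Require Import all_boot all_order all_algebra.
From mathcomp Require Import all_classical all_reals all_analysis.
Set Implicit Arguments. Unset Strict Implicit. Unset Printing Implicit Defensive.
Import Order.TTheory GRing.Theory Num.Theory.
Local Open Scope classical_set_scope.
Local Open Scope ring_scope.

Section LTD.
Variables (R : realType) (V : finType).

(** Configurations x in X = {-1,+1}^V, encoded by booleans: true = +1, false = -1. *)
Definition config := V -> bool.

Definition spin (b : bool) : R := if b then 1 else -1.

Definition loc_field (W : V -> V -> R) (h : V -> R) (x : config) (i : V) : R :=
  \sum_(j : V) W i j * spin (x j) + h i.

Definition utility (W : V -> V -> R) (h : V -> R) (x : config) (i : V) : R :=
  spin (x i) * loc_field W h x i.

Definition set_action (x : config) (i : V) (a : bool) : config :=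
  fun j => if j == i then a else x j.

Definition is_equilibrium (W : V -> V -> R) (h : V -> R) (x : config) : Prop :=
  forall (i : V) (a : bool), utility W h (set_action x i a) i <= utility W h x i.

Definition ltd_update (W : V -> V -> R) (h : V -> R) (i : V) (x : config) : config :=
  fun j => if j == i then
             (if 0 < loc_field W h x i then true
              else if loc_field W h x i < 0 then false else x i)
           else x j.

(** [ltd_path W h tick x0 x]: the trajectory x : R -> config (times t >= 0) is
    the LTD driven by the tick times [tick i t] ("agent i's clock ticks at time t")
    started at x0: x(0) = x0, x is constant on any interval [s,t] with no tick
    in (s,t], and at a tick time t of agent i, x(t) = update_i(x(t^-)), where
    x(t^-) = x(s) for some s < t such that there is no tick in (s,t). *)
Definition ltd_path (W : V -> V -> R) (h : V -> R) (tick : V -> set R)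
    (x0 : config) (x : R -> config) : Prop :=
  [/\ x 0 = x0,
      (forall s t, 0 <= s -> s <= t ->
         (forall j u, s < u -> u <= t -> ~ tick j u) -> x t = x s) &
      (forall i t, 0 < t -> tick i t ->
         exists s, [/\ 0 <= s, s < t,
           (forall j u, s < u -> u < t -> ~ tick j u) &
           x t = ltd_update W h i (x s)])].

End LTD.

Section Clocks.
Variables (d : measure_display) (T : measurableType d) (R : realType)
  (P : probability T R) (V : finType).

Definition tick_time (tau : nat -> T -> R) (k : nat) (w : T) : R :=
  \sum_(m < k.+1) tau m w.

Definition ticks (tau : V -> nat -> T -> R) (w : T) : V -> set R :=
  fun i t => exists k, tick_time (tau i) k w = t.

(** Independent rate-1 Poisson clocks: the inter-arrival times tau i k are
    random variables, each Exp(1)-distributed, and the whole family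
    (indexed by V * nat) is mutually independent. *)
Definition poisson_clocks (tau : V -> nat -> T -> R) : Prop :=
  [/\ (forall i k, measurable_fun setT (tau i k)),
      (forall i k (A : set R), measurable A ->
         P (tau i k @^-1` A) = exponential_prob (1 : R) A) &
      (forall (F : seq (V * nat)) (B : V * nat -> set R),
         uniq F -> (forall j, measurable (B j)) ->
         P (\bigcap_(j in [set` F]) (tau j.1 j.2 @^-1` B j)) =
         (\prod_(j <- F) P (tau j.1 j.2 @^-1` B j))%E)].

End Clocks.

(* Main.v *)
(** A configuration from which no agent wants to move up keeps that property under downward
    moves, since W >= 0 makes the local fields monotone in the configuration. Hence upward
    moves followed by downward moves lead from any configuration to an equilibrium, and since
    equilibria are fixed by all updates, concatenating such paths over the finitely many
    configurations gives one word u of agents that drives every configuration to an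
    equilibrium. It remains to see u occur, almost surely, as a string of consecutive ticks.

    Cut time into slots (2l, 2l+2]. Given the past up to time 2l, the probability that in the
    next slot agent i ticks once and nobody else ticks is at least c > 0, so the probability
    that u is not spelled out in any of n successive blocks of |u| slots is at most
    (1 - c^|u|)^n. The conditional bound needs no integration over the past: rounding the time
    elapsed since the last tick of each agent down to an integer z, both "no tick since then"
    and a sufficient condition for the next slot become rectangles in waiting times which are
    independent of the past, and the ratio of their probabilities does not depend on z. *)

Require Import Defs.
From HB Require Import structures.
From mathcomp Require Import all_boot all_order all_algebra.
From mathcomp Require Import all_classical all_reals all_analysis.
From mathcomp Require Import lra.
Import Order.TTheory GRing.Theory Num.Theory numFieldNormedType.Exports.
Local Open Scope classical_set_scope.
Local Open Scope ring_scope.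
Set Implicit Arguments. Unset Strict Implicit. Unset Printing Implicit Defensive.

(** * Words driving every configuration to an equilibrium *)

Section Game.
Variables (R : realType) (V : finType) (W : V -> V -> R) (h : V -> R).
Hypotheses (W_ge0 : forall i j, 0 <= W i j) (W_diag : forall i, W i i = 0).

Let field := loc_field W h.
Let upd := ltd_update W h.
Let eqm := is_equilibrium W h.

Lemma loc_field_set_action x i a : field (set_action x i a) i = field x i.
Proof.
rewrite /field /loc_field; congr (_ + _); apply: eq_bigr => j _.
by rewrite /set_action; case: eqP => // ->; rewrite W_diag !mul0r.
Qed.

(** By the zero diagonal, a deviation keeps the agent's local field and only flips the sign of its
    utility; hence a weak sign condition, which a zero field always meets. *)
Lemma is_equilibriumP x :
  eqm x <-> forall i, if x i then 0 <= field x i else field x i <= 0.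
Proof.
split=> [xeq i|xeq i a].
  have := xeq i (~~ x i); rewrite /utility -/field loc_field_set_action.
  rewrite /set_action eqxx /spin; case: (x i) => /=; lra.
rewrite /utility -/field loc_field_set_action /set_action eqxx /spin.
by have := xeq i; case: (x i); case: a; lra.
Qed.

(** A nonzero field already has the sign of the spin, and at a zero field the update keeps the
    action. *)
Lemma ltd_update_equilibrium x i : eqm x -> upd i x = x.
Proof.
move=> /is_equilibriumP xeq; apply/funext => j; rewrite /upd /ltd_update -/field.
case: eqP => // ->; have := xeq i.
by case: (ltgtP (field x i) 0) => //; case: (x i).
Qed.

Definition run (u : seq V) (x : config V) : config V := foldl (fun y i => upd i y) x u.

Lemma run_cat u v x : run (u ++ v) x = run v (run u x).
Proof. exact: foldl_cat. Qed.

Lemma run_equilibrium u x : eqm x -> run u x = x.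
Proof. by move=> xeq; elim: u => //= i u IH; rewrite ltd_update_equilibrium. Qed.

Lemma ltd_update_down x i : field x i < 0 -> upd i x = set_action x i false.
Proof.
move=> x0; apply/funext => j; rewrite /upd /ltd_update /set_action -/field.
by rewrite x0 (lt_gtF x0).
Qed.

Lemma ltd_update_up x i : 0 < field x i -> upd i x = set_action x i true.
Proof.
by move=> x0; apply/funext => j; rewrite /upd /ltd_update /set_action -/field x0.
Qed.

Lemma loc_field_down x i j : field (set_action x i false) j <= field x j.
Proof.
rewrite /field /loc_field lerD2r; apply: ler_sum => k _.
rewrite ler_wpM2l// /set_action; case: eqP => // _.
by rewrite /spin; case: (x k); lra.
Qed.

(** Decreasing measure for the upward moves ([a] true) and for the downward moves ([a] false). *)
Lemma card_set_action x i a : x i != a ->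
  (#|[pred j : V | set_action x i a j != a]| < #|[pred j : V | x j != a]|)%N.
Proof.
move=> xia; apply: proper_card; apply/properP; split.
  apply/fintype.subsetP => j; rewrite !inE /set_action.
  by case: (j == i); case: a {xia}; case: (x j).
exists i; rewrite inE/= ?xia// /set_action. by rewrite eqxx; case: a {xia}.
Qed.

Definition no_up (x : config V) := forall i, ~~ x i -> field x i <= 0.

Lemma run_no_up x : exists u, no_up (run u x).
Proof.
have [n] := ubnP #|[pred j : V | x j != true]|; elim: n x => // n IH x xn.
have [xup|] := pselect (no_up x); first by exists [::].
move=> /existsNP[i /not_implyP[xi /negP]]; rewrite -ltNge => fi.
have [|u uP] := IH (upd i x); last by exists (i :: u).
by rewrite ltd_update_up// (leq_trans (card_set_action _))//; case: (x i) xi.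
Qed.

(** Under [no_up] only an agent at [true] can violate equilibrium. Its downward move raises no
    field, and its own field is negative, so [no_up] persists. *)
Lemma run_no_up_equilibrium x : no_up x -> exists u, eqm (run u x).
Proof.
have [n] := ubnP #|[pred j : V | x j != false]|; elim: n x => // n IH x xn xup.
have [xeq|] := pselect (eqm x); first by exists [::].
move=> /is_equilibriumP/existsNP[i]; case: ifPn => [xi|xi]; last first.
  by move=> /negP; rewrite xup.
move=> /negP; rewrite -ltNge => fi.
have [| |u uP] := IH (upd i x); last by exists (i :: u).
  by rewrite ltd_update_down// (leq_trans (card_set_action _))// xi.
rewrite ltd_update_down// => j; rewrite /set_action.
have := loc_field_down x i j; have := xup j.
by case: eqP => [->|_]; [lra|case: (x j) => //=; lra].
Qed.

Lemma run_to_equilibrium x : exists u, eqm (run u x).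
Proof.
have [u /run_no_up_equilibrium[v uv]] := run_no_up x.
by exists (u ++ v); rewrite run_cat.
Qed.

(** As the word works from every start, it can be awaited in the clocks alone, whatever the
    configuration at that moment. *)
Lemma universal_word : exists u, forall x, eqm (run u x).
Proof.
(* Finite functions give a finite list of all configurations to induct on. *)
suff [u uP] : exists u, forall x, x \in enum {ffun V -> bool} -> eqm (run u x).
  exists u => x; have := uP (finfun x); rewrite mem_enum inE => /(_ isT).
  by congr (eqm (run u _)); apply/funext => i; rewrite ffunE.
elim: (enum _) => [|y ys [u uP]]; first by exists [::].
have [v vP] := run_to_equilibrium (run u y).
(* [v] treats [y] from where [u] leaves it; the configurations already settled by [u] stay put. *)
exists (u ++ v) => x; rewrite inE run_cat => /predU1P[->//|xys].
by rewrite run_equilibrium; exact: uP.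
Qed.

End Game.

(** * Trajectories of the dynamics *)

Section Path.
Variables (R : realType) (V : finType) (W : V -> V -> R) (h : V -> R).
Variable s : V -> nat -> R.
Hypothesis s_mono : forall i k, s i k < s i k.+1.

(** The shift skips [s i 0], which stands for the time origin and is no tick; for arrival times this
    is [ticks] by conversion. *)
Let tick : V -> set R := fun i t => exists k, s i k.+1 = t.

Definition counts (k : V -> nat) (t : R) := forall i, s i (k i) <= t < s i (k i).+1.

(** Taking [k] among finite functions makes the existential range over a countable type, as
    measurability will require. *)
Definition slot (l : nat) (i : V) :=
  exists k : {ffun V -> nat}, counts k l.*2%:R /\
    counts (fun j => k j + (j == i))%N l.+1.*2%:R.

Fixpoint slots (l : nat) (u : seq V) : Prop :=
  if u is i :: u' then slot l i /\ slots l.+1 u' else True.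

Variables (x0 : config V) (x : R -> config V).
Hypothesis xP : ltd_path W h tick x0 x.

Let s_le i : {mono s i : m n / (m <= n)%N >-> m <= n}.
Proof. by apply: le_mono; apply: homo_ltn => //; exact: lt_trans. Qed.

Let s_lt i : {mono s i : m n / (m < n)%N >-> m < n}.
Proof. by move=> m n; rewrite !ltNge s_le ltnNge. Qed.

Let tick_counts k a b j u : counts k a -> b < s j (k j).+1 -> a < u -> u <= b ->
  ~ tick j u.
Proof.
move=> /(_ j)/andP[ka _] bk au ub [m mu].
have : s j (k j) < s j m.+1 by rewrite mu (le_lt_trans ka).
have : s j m.+1 < s j (k j).+1 by rewrite mu (le_lt_trans ub).
by rewrite !s_lt ltnS => /leq_ltn_trans/[apply]; rewrite ltnn.
Qed.

(** Both [a] and the time [s'] supplied by [ltd_path] are followed by quiet intervals up to [t], so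
    constancy from the earlier to the later one identifies their configurations. *)
Lemma pre_tick_config i t a : 0 <= a -> a < t -> tick i t ->
  (forall j u, a < u -> u < t -> ~ tick j u) -> x t = ltd_update W h i (x a).
Proof.
move=> a0 at_ tick_t quiet; case: xP => _ const jump.
have [s' [s'0 s't s'quiet ->]] := jump i t (le_lt_trans a0 at_) tick_t.
congr (ltd_update _ _ _ _); have [as'|s'a] := leP a s'.
  by apply: const => // j u au us'; apply: quiet => //; exact: le_lt_trans s't.
apply/esym/const => //; first exact: ltW.
by move=> j u s'u ua; apply: s'quiet => //; exact: le_lt_trans at_.
Qed.

(** The single tick [t] cuts the slot into two quiet pieces, on which the trajectory is constant. *)
Lemma slot_update l i : slot l i ->
  x l.+1.*2%:R = ltd_update W h i (x l.*2%:R).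
Proof.
move=> [k [ka kb]]; set a := _%:R in ka *; set b := _%:R in kb *.
have a0 : 0 <= a by rewrite ler0n.
have /andP[_ at_] := ka i; have /andP[] := kb i.
rewrite eqxx addn1; set t := s i _ in at_ * => tb tb'.
have tickt : tick i t by exists (k i).
case: (xP) => _ const _.
rewrite (const t b) ?(le_trans a0 (ltW at_))//; last first.
  move=> j u tu ub; have [ji|ji] := eqVneq j i.
    (* Another tick of [i] would have an index strictly between [(k i).+1] and [(k i).+2]. *)
    rewrite {}ji => -[m mu]; move: tu tb'; rewrite -mu /t s_lt => km.
    move/(le_lt_trans ub); rewrite -mu s_lt.
    by rewrite ltnS leqNgt km.
  apply: (tick_counts ka _ (lt_trans at_ tu) ub).
  by have /andP[_] := kb j; rewrite (negbTE ji) addn0.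
apply: pre_tick_config => // j u au ut.
apply: (tick_counts ka _ au (lexx u)).
have [->//|ji] := eqVneq j i.
apply: (lt_trans ut); apply: (le_lt_trans tb).
by have /andP[_] := kb j; rewrite (negbTE ji) addn0.
Qed.

Lemma slots_run u l : slots l u ->
  x (l + size u).*2%:R = run W h u (x l.*2%:R).
Proof.
elim: u l => [|i u IH] l /=; first by rewrite addn0.
by move=> [/slot_update <- /IH]; rewrite addnS addSn.
Qed.

Hypothesis W_diag : forall i, W i i = 0.
Hypothesis s_unbounded : forall i t, exists k, t < s i k.

(** Induction on the number of ticks in [(a, u]], finite since arrival times are unbounded; the
    update at the last tick [r] fixes the equilibrium. *)
Lemma equilibrium_absorbing a : 0 <= a -> is_equilibrium W h (x a) ->
  forall t, a <= t -> x t = x a.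
Proof.
move=> a0 xa_eq t at_.
have [N NP] : exists N, forall j, t < s j N.
  pose N j := projT1 (cid (s_unbounded j t)).
  exists (\max_j N j) => j; apply: lt_le_trans (projT2 (cid (s_unbounded j t))) _.
  by rewrite s_le; exact: leq_bigmax.
(* Since [t < s j N], the bound [N] captures all ticks up to [t] in a finite type. *)
pose past u := [pred p : V * 'I_N | a < s p.1 p.2.+1 <= u].
suff : forall u, a <= u -> u <= t -> x u = x a by apply.
move=> u; have [n] := ubnP #|past u|; elim: n u => // n IH u un au ut.
case: (xP) => _ const _.
case: (pickP (past u)) => [p0 p0P|no_past]; last first.
  apply: const => // j v av vu [m mv].
  have mN : (m < N)%N.
    by rewrite -(s_lt j) (lt_trans _ (NP j))// (lt_le_trans (s_mono _ _))// mv (le_trans vu).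
  by have := no_past (j, Ordinal mN); rewrite /= mv av vu.
case: (@Order.TotalTheory.arg_maxP _ _ _ p0 (past u) (fun p => s p.1 p.2.+1) p0P).
move=> [j m] /= /andP[ar ru] rmax; set r := s j m.+1 in ar ru rmax.
have no_tick v i : r < v -> v <= u -> ~ tick i v.
  move=> rv vu [q qv].
  have qN : (q < N)%N.
    by rewrite -(s_lt i) (lt_trans _ (NP i))// (lt_le_trans (s_mono _ _))// qv (le_trans vu).
  have := rmax (i, Ordinal qN); rewrite /= qv vu (lt_trans ar)// => /(_ isT).
  by rewrite leNgt rv.
have r0 : 0 <= r by rewrite (le_trans a0)// ltW.
rewrite (const r u)//; last by move=> *; exact: no_tick.
have tickr : tick j r by exists m.
case: (xP) => _ _ /(_ j r (le_lt_trans a0 ar) tickr)[r' [r'0 r'r quiet ->]].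
suff -> : x r' = x a by exact: ltd_update_equilibrium.
(* If [r'] precedes [a], no tick separates them; otherwise induction applies at [r'], where the tick
   [(j, m)] is no longer counted. *)
have [r'a|ar'] := leP r' a.
  apply/esym/const => // i v r'v va; apply: quiet => //; exact: le_lt_trans ar.
apply: IH; [|exact: ltW|by rewrite (le_trans (ltW r'r))// (le_trans ru)].
rewrite ltnS in un; apply: leq_trans un; apply: proper_card; apply/properP; split.
  apply/fintype.subsetP => p; rewrite !inE => /andP[-> /=].
  by move=> /le_trans; apply; rewrite (le_trans (ltW r'r)).
exists (j, m); rewrite !inE /= ?ar ?ru// negb_and orbC.
by rewrite -ltNge r'r.
Qed.

End Path.

(** * Independence and exponential waiting times *)

Lemma measurable_preimage (d : measure_display) (T : measurableType d) (R : realType)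
    (f : T -> R) (B : set R) :
  measurable_fun setT f -> measurable B -> measurable (f @^-1` B).
Proof. by move=> mf mB; rewrite -[X in measurable X]setTI; exact: mf. Qed.

Lemma measurable_forall (d : measure_display) (T : measurableType d) (I : finType)
    (F : I -> set T) :
  (forall i, measurable (F i)) -> measurable [set w | forall i, F i w].
Proof.
move=> mF; have -> : [set w | forall i, F i w] = \bigcap_(i in setT) F i.
  by apply/seteqP; split=> w /= wF; [move=> i _|move=> i]; exact: wF.
by apply: fin_bigcap_measurable => [|i _]; [exact: finite_finset|exact: mF].
Qed.

Lemma exponential_tail (d : measure_display) (T : measurableType d)
    (R : realType) (P : probability T R) (X : T -> R) (t : R) :
  measurable_fun setT X ->
  (forall A, measurable A -> P (X @^-1` A) = exponential_prob (1 : R) A) ->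
  0 <= t -> P (X @^-1` [set x | t < x]) = (expR (- t))%:E.
Proof.
move=> mX lawX t0.
have mpre B : measurable B -> measurable (X @^-1` B) by exact: measurable_preimage.
pose N : set R := `]-oo, 0[%classic; pose J : set R := `[0, t]%classic.
have mN : measurable N by exact: measurable_itv.
have mJ : measurable J by exact: measurable_itv.
have -> : [set x | t < x] = ~` (N `|` J).
  apply/seteqP; split=> x; rewrite /= /N /J /= !in_itv/= ?andbT.
    by move=> tx [x0|/andP[_ xt]]; lra.
  by move=> /not_orP[/negP + /negP]; rewrite negb_and -!leNgt -!ltNge => x0; lra.
rewrite -preimage_setC probability_setC; last by apply: mpre; exact: measurableU.
have -> : P (X @^-1` (N `|` J)) = (P (X @^-1` N) + P (X @^-1` J))%E.
  rewrite preimage_setU; apply: measureU; [exact: mpre|exact: mpre|].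
  by apply/seteqP; split=> w //; rewrite /N /J /= !in_itv/= => -[]; lra.
rewrite !lawX// [exponential_prob _ N]integral0_eq ?add0e; last first.
  by move=> x; rewrite /N /= in_itv/= => x0; rewrite lt0_exponential_pdf.
rewrite /J {mJ}.
(* The formula for the interval from 0 to [t] needs [0 < t]. *)
have [->|tn0] := eqVneq t 0.
  by rewrite set_itv1 /exponential_prob integral_set1 oppr0 expR0 sube0.
rewrite exponential_prob_itv0c ?lt_neqAle 1?eq_sym ?tn0// mulN1r.
by rewrite -!EFinB opprB addrC subrK.
Qed.

Section Independence.
Variables (d : measure_display) (T : measurableType d) (R : realType).
Variables (P : probability T R) (I : choiceType) (X : I -> T -> R).
Hypothesis mX : forall i, measurable_fun setT (X i).
Hypothesis indep : forall (F : seq I) (B : I -> set R),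
  uniq F -> (forall i, measurable (B i)) ->
  P (\bigcap_(i in [set` F]) (X i @^-1` B i)) = (\prod_(i <- F) P (X i @^-1` B i))%E.

Definition cylinder (F : seq I) (B : I -> set R) : set T :=
  \bigcap_(i in [set` F]) (X i @^-1` B i).

(** The pi-system of rectangles generating the sigma-algebra of the variables indexed by [F]. *)
Definition cylinders (F : seq I) : set (set T) :=
  [set A | exists2 B, (forall i, measurable (B i)) & A = cylinder F B].

Lemma measurable_cylinder F B : (forall i, measurable (B i)) ->
  measurable (cylinder F B).
Proof.
move=> mB; apply: fin_bigcap_measurable => // i _; exact: measurable_preimage.
Qed.

Lemma cylinders_setI F : setI_closed (cylinders F).
Proof.
move=> _ _ [B mB ->] [C mC ->]; exists (fun i => B i `&` C i).
  by move=> i; exact: measurableI.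
by rewrite /cylinder -bigcapI; apply: eq_bigcapr => i _; rewrite preimage_setI.
Qed.

Lemma cylinders_setT F : cylinders F setT.
Proof.
by exists (fun=> setT) => //; rewrite /cylinder bigcapT.
Qed.

Lemma sigma_cylinders_measurable F : <<s cylinders F >> `<=` measurable.
Proof.
apply: smallest_sub; first exact: sigma_algebra_measurable.
by move=> _ [B mB ->]; exact: measurable_cylinder.
Qed.

Lemma sigma_cylinders_X F i : i \in F ->
  @measurable_fun _ _ (g_sigma_algebraType (cylinders F)) R setT (X i).
Proof.
move=> iF _ B mB; rewrite setTI; apply: sub_sigma_algebra.
exists (fun j => if j == i then B else setT); first by move=> j; case: ifP.
apply/seteqP; split=> [w Bw j _|w /(_ i iF)] /=; last by rewrite eqxx.
by case: eqP => [->|].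
Qed.

(** Both sides are finite measures in [A] that agree on the pi-system [cylinders F], hence on the
    sigma-algebra it generates. *)
Lemma indep_cylinder F G A B : uniq (F ++ G) -> (forall i, measurable (B i)) ->
  <<s cylinders F >> A ->
  P (A `&` cylinder G B) = (P A * \prod_(i <- G) P (X i @^-1` B i))%E.
Proof.
move=> FG mB FA; have mC := measurable_cylinder G mB.
have := FG; rewrite cat_uniq => /and3P[_ /hasPn FG0 uG].
rewrite -indep// -/(cylinder G B).
have r0 : 0 <= fine (P (cylinder G B)) by exact: fine_ge0.
have Pfin : P (cylinder G B) \is a fin_num by exact: fin_num_measure.
rewrite muleC -(fineK Pfin).
change (mrestr P mC A = mscale (NngNum r0) P A).
apply: (@g_sigma_algebra_measure_unique _ _ _ (cylinders F) _ (fun=> setT)) => //.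
- by move=> _ [C mC' ->]; exact: measurable_cylinder.
- by move=> _; exact: cylinders_setT.
- by rewrite bigcup_const.
- exact: cylinders_setI.
- move=> _ [C mC' ->].
  change (P (cylinder F C `&` cylinder G B) =
    (fine (P (cylinder G B)))%:E * P (cylinder F C))%E; rewrite fineK//.
  (* As [F] and [G] are disjoint, the two families glue into one and the intersection is again a
     rectangle. *)
  pose D i := if i \in F then C i else B i.
  have mD i : measurable (D i) by rewrite /D; case: ifP.
  have -> : cylinder F C `&` cylinder G B = cylinder (F ++ G) D.
    rewrite /cylinder; apply/seteqP; split=> [w [wC wB] i|w wD].
      rewrite /= mem_cat => /orP[iF|iG].
        by rewrite /D iF; exact: wC.
      by rewrite /D (negbTE (FG0 _ iG)); exact: wB.
    split=> i /= iF; have := wD i; rewrite /= mem_cat iF ?orbT /D => /(_ isT).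
      by rewrite iF.
    by rewrite (negbTE (FG0 _ iF)).
  rewrite /cylinder !indep// ?(subseq_uniq _ FG) ?prefix_subseq// big_cat muleC /=.
  congr (_ * _)%E; apply: eq_big_seq => i iF; rewrite /D ?iF//.
  by rewrite (negbTE (FG0 _ iF)).
- by move=> _; change (P (setT `&` cylinder G B) < +oo)%E; rewrite setTI ltey_eq Pfin.
Qed.

End Independence.

(** * Comparing two events cell by cell on an almost sure countable partition *)

Section Cover.
Variables (d : measure_display) (T : measurableType d) (R : realType).
Variable P : probability T R.

Lemma probability_setI_full (A U : set T) : measurable A -> measurable U ->
  P (~` U) = 0%E -> P (A `&` U) = P A.
Proof.
move=> mA mU U0; have -> : P A = (P (A `&` U) + P (A `&` ~` U))%E.
  rewrite -[in LHS](setIT A) -(setUv U) setIUr; apply: measureU.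
  - exact: measurableI.
  - by apply: measurableI => //; exact: measurableC.
  - by rewrite setIACA setICr setI0.
suff -> : P (A `&` ~` U) = 0%E by rewrite adde0.
have mU' : measurable (~` U) by exact: measurableC.
apply/eqP; rewrite eq_le measure_ge0 andbT -U0.
by apply: le_measure; rewrite ?inE//; exact: measurableI.
Qed.

Lemma probability_le_cover (J : countType) (Q : J -> set T) (A B : set T) (c : R) :
  0 <= c -> measurable A -> measurable B -> (forall j, measurable (Q j)) ->
  trivIset setT Q -> P (~` \bigcup_j Q j) = 0%E ->
  (forall j, (c%:E * P (A `&` Q j) <= P (B `&` Q j))%E) -> (c%:E * P A <= P B)%E.
Proof.
move=> c0 mA mB mQ tQ Q0 AB.
(* Reindexing by natural numbers, with empty cells at numbers that code nothing. *)
pose Q' n := if @pickle_inv J n is Some j then Q j else set0.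
have QE : \bigcup_j Q j = \bigcup_n Q' n.
  apply/seteqP; split=> w [].
    by move=> j _ Qj; exists (pickle j) => //; rewrite /Q' pickleK_inv.
  by move=> n _; rewrite /Q'; case: (pickle_inv n) => // j Qj; exists j.
have mQ' n : measurable (Q' n) by rewrite /Q'; case: (pickle_inv n).
have tQ' : trivIset setT Q'.
  move=> m n _ _ [w]; rewrite /Q'.
  have := @pickle_invK J m; have := @pickle_invK J n.
  case: (pickle_inv m) => [j|] /=; case: (pickle_inv n) => [j'|] /=; try by move=> _ _ [].
  move=> <- <- [wj wj']; congr pickle; apply: tQ => //; by exists w.
have mU : measurable (\bigcup_n Q' n) by exact: bigcupT_measurable.
have sum C : measurable C -> P C = (\sum_(0 <= n <oo) P (C `&` Q' n))%E.
  move=> mC; rewrite -(probability_setI_full mC mU) -?QE// QE setI_bigcupr.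
  apply: measure_semi_bigcup => //.
  - by move=> n; exact: measurableI.
  - exact: trivIset_setIl.
  - by apply: bigcupT_measurable => n; exact: measurableI.
rewrite (sum A)// (sum B)// -nneseriesZl//.
apply: lee_nneseries => [n _ _|n _].
  by apply: mule_ge0; rewrite ?lee_fin// measure_ge0.
by rewrite /Q'; case: (pickle_inv n) => // ; rewrite !setI0 measure0 mule0.
Qed.

End Cover.

(** * Poisson clocks *)

Section Clocks.
Variables (d : measure_display) (T : measurableType d) (R : realType).
Variables (P : probability T R) (V : finType) (tau : V -> nat -> T -> R).
Hypothesis clocks : poisson_clocks P tau.

Definition arrival (i : V) (k : nat) (w : T) : R := \sum_(m < k) tau i m w.

(** The samples with strictly increasing, unbounded arrival times; integer bounds keep this a
    countable combination of events. *)
Definition good : set T := [set w | forall i,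
  (forall k, 0 < tau i k w) /\ (forall n : nat, exists k, n%:R < arrival i k w)].

Definition count_event (k : V -> nat) (t : R) : set T :=
  [set w | counts (fun i m => arrival i m w) k t].

Definition slot_event (l : nat) (i : V) : set T :=
  [set w | slot (fun i m => arrival i m w) l i].

Definition slots_event (l : nat) (u : seq V) : set T :=
  [set w | slots (fun i m => arrival i m w) l u].

Let X (p : V * nat) : T -> R := tau p.1 p.2.

Let mX p : measurable_fun setT (X p).
Proof. by case: clocks => + _ _; apply. Qed.

Let indep (F : seq (V * nat)) (B : V * nat -> set R) :
  uniq F -> (forall j, measurable (B j)) ->
  P (\bigcap_(p in [set` F]) (X p @^-1` B p)) = (\prod_(p <- F) P (X p @^-1` B p))%E.
Proof. by case: clocks => _ _; apply. Qed.

(** Indices of the waiting times completed once each agent [j] has ticked [k j] times. *)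
Definition seen (k : V -> nat) : seq (V * nat) :=
  [seq (j, m) | j <- enum V, m <- iota 0 (k j)].

Lemma mem_seen k j m : ((j, m) \in seen k) = (m < k j)%N.
Proof.
apply/allpairsPdep/idP => [[j' [m' [_ + [-> ->]]]]|mk].
  by rewrite mem_iota add0n.
by exists j, m; rewrite mem_enum mem_iota.
Qed.

Lemma uniq_seen k : uniq (seen k).
Proof.
apply: allpairs_uniq_dep => [|j _|]; rewrite ?enum_uniq ?iota_uniq//.
by move=> [j m] [j' m'] _ _ /= [-> ->].
Qed.

Definition past (k : V -> nat) : set (set T) := <<s cylinders X (seen k) >>.

(** A copy of the sample space whose measurable sets are the past, so that general measurability
    lemmas apply to it. *)
Let pastT k := g_sigma_algebraType (cylinders X (seen k)).

Lemma past_arrival k i m : (m <= k i)%N ->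
  @measurable_fun _ _ (pastT k) R setT (arrival i m).
Proof.
move=> mk; apply: (@measurable_sum _ (pastT k)) => r.
apply: (@sigma_cylinders_X _ T R _ X (seen k) (i, val r)).
by rewrite mem_seen (leq_trans (ltn_ord r)).
Qed.

Lemma past_preimage k i m (B : set R) : (m <= k i)%N -> measurable B ->
  past k (arrival i m @^-1` B).
Proof.
by move=> mk; apply: (@measurable_preimage _ (pastT k)); exact: past_arrival.
Qed.

Lemma past_measurable k : past k `<=` measurable.
Proof. exact: sigma_cylinders_measurable. Qed.

Lemma past_forall k (F : V -> set T) : (forall j, past k (F j)) ->
  past k [set w | forall j, F j w].
Proof. exact: (@measurable_forall _ (pastT k)). Qed.

Lemma arrivalS i m w : arrival i m.+1 w = arrival i m w + tau i m w.
Proof. by rewrite /arrival big_ord_recr. Qed.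

Lemma arrival0 i w : arrival i 0 w = 0.
Proof. by rewrite /arrival big_ord0. Qed.

Lemma good_arrival_mono w : good w -> forall i m, arrival i m w < arrival i m.+1 w.
Proof. by move=> gw i m; rewrite arrivalS ltrDl; have [] := gw i. Qed.

Lemma good_arrival_le w : good w -> forall i, {mono (arrival i)^~ w : m n / (m <= n)%N >-> m <= n}.
Proof.
move=> gw i; apply: le_mono; apply: homo_ltn; first exact: lt_trans.
by move=> m; exact: good_arrival_mono.
Qed.

Lemma good_arrival_unbounded w : good w -> forall i t, exists k, t < arrival i k w.
Proof.
move=> gw i t; have [_ /(_ (Num.truncn t).+1)[k tk]] := gw i; exists k.
exact: lt_trans (truncnS_gt t) tk.
Qed.

(** The natural filtration of the counting processes, sampled at even times. *)
Definition history (l : nat) : set (set T) :=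
  <<s [set A | exists (k : V -> nat) t, t <= l.*2%:R /\ A = count_event k t] >>.

Let historyT l := g_sigma_algebraType
  [set A | exists (k : V -> nat) t, t <= l.*2%:R /\ A = count_event k t].

Lemma history_count l k t : t <= l.*2%:R -> history l (count_event k t).
Proof. by move=> tl; apply: sub_sigma_algebra; exists k, t. Qed.

Lemma history_le l l' : (l <= l')%N -> history l `<=` history l'.
Proof.
move=> ll'; apply: smallest_sub; first exact: smallest_sigma_algebra.
move=> _ [k [t [tl ->]]]; apply: history_count.
by rewrite (le_trans tl)// ler_nat leq_double.
Qed.

Lemma history_slot l i : history l.+1 (slot_event l i).
Proof.
have -> : slot_event l i = \bigcup_(k : {ffun V -> nat})
   (count_event k l.*2%:R `&` count_event (fun j => k j + (j == i))%N l.+1.*2%:R).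
  by apply/seteqP; split=> [w [k kP]|w [k _ kP]]; exists k.
apply: (@countable_bigcupT_measurable _ (historyT l.+1)) => [|k]; first exact: countableP.
apply: (@measurableI _ (historyT l.+1)); apply: history_count => //.
by rewrite ler_nat leq_double.
Qed.

Lemma history_setC l A : history l A -> history l (~` A).
Proof. exact: (@measurableC _ (historyT l)). Qed.

Lemma history_setI l A B : history l A -> history l B -> history l (A `&` B).
Proof. exact: (@measurableI _ (historyT l)). Qed.

Lemma history_slots l u : history (l + size u) (slots_event l u).
Proof.
elim: u l => [|i u IH] l /=; first exact: (@measurableT _ (historyT _)).
rewrite addnS -addSn; apply: history_setI (IH _).
by apply: (@history_le l.+1); [rewrite leq_addr|exact: history_slot].
Qed.

(* On the event that agent j has ticked k j times by time 2l, for all j, the history up to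
   time 2l only depends on the first k j waiting times of each j. *)
Lemma history_past l A k : history l A ->
  exists2 B, past k B & forall w, count_event k l.*2%:R w -> good w -> A w <-> B w.
Proof.
(* The sets [A] admitting such a [B] form a sigma-algebra, so generators suffice. *)
move: A; apply: smallest_sub.
  split=> [|A [B pB AB]|A pA].
  - by exists set0 => //; exact: (@measurable0 _ (pastT k)).
  - exists (~` B); first exact: (@measurableC _ (pastT k)).
    by move=> w kw gw; rewrite setTD; split; apply: contra_not => /(AB _ kw gw).
  - pose B n := s2val (cid2 (pA n)).
    have pB n : past k (B n) by exact: s2valP (cid2 (pA n)).
    have AB n := s2valP' (cid2 (pA n)).
    exists (\bigcup_n B n); first exact: (@bigcupT_measurable _ (pastT k)).
    by move=> w kw gw; split=> -[n _ /(AB n _ kw gw) ABw]; exists n.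
move=> _ [k' [t [tl ->]]].
(* The tick after the first [k' j] ones is visible in the past only if [k' j < k j]. In case of
   equality it comes after [2l], hence after [t]; a larger [k' j] is impossible. *)
pose F j := if (k' j <= k j)%N then
  arrival j (k' j) @^-1` `]-oo, t] `&`
  (if (k' j < k j)%N then arrival j (k' j).+1 @^-1` `]t, +oo[ else setT) else set0.
exists [set w | forall j, F j w].
  apply: past_forall => j; rewrite /F.
  case: ifPn => [k'k|_]; last exact: (@measurable0 _ (pastT k)).
  apply: (@measurableI _ (pastT k)); first exact: past_preimage.
  by case: ifPn => [?|_]; [exact: past_preimage|exact: (@measurableT _ (pastT k))].
move=> w kw gw; split=> Hw j; have /andP[kj kj'] := kw j; move: (Hw j); rewrite /F.
  move=> /andP[k't k't'].
  have k'k : (k' j <= k j)%N.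
    rewrite leqNgt -(ltn_add2l 0) !add0n; apply/negP => kk'.
    have := le_trans k't tl; rewrite leNgt (lt_le_trans kj')//.
    by rewrite good_arrival_le.
  rewrite k'k; split; first by rewrite /= in_itv.
  by case: ifPn => // _; rewrite /= in_itv/= k't'.
case: ifPn => // k'k [/= + ]; rewrite in_itv/= => -> /=.
case: ifPn => [_|]; first by rewrite /= in_itv/= andbT.
rewrite -leqNgt => kk' _; have -> : k' j = k j by apply/eqP; rewrite eqn_leq k'k.
exact: le_lt_trans tl _.
Qed.

Lemma measurable_arrival i m : measurable_fun setT (arrival i m).
Proof. by apply: measurable_sum => r; exact: (mX (i, val r)). Qed.

Lemma measurable_good : measurable good.
Proof.
apply: (measurable_forall (F := fun i => [set w | (forall k, 0 < tau i k w) /\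
  (forall n : nat, exists k, n%:R < arrival i k w)])) => i.
have -> : [set w | (forall k, 0 < tau i k w) /\
    (forall n : nat, exists k, n%:R < arrival i k w)] =
  (\bigcap_k (tau i k @^-1` `]0, +oo[)) `&`
  \bigcap_n \bigcup_k (arrival i k @^-1` `]n%:R, +oo[).
  apply/seteqP; split=> w [w0 wn]; split.
  - by move=> k _; rewrite /= in_itv/= w0.
  - by move=> n _; have [k nk] := wn n; exists k => //; rewrite /= in_itv/= nk.
  - by move=> k; have := w0 k I; rewrite /= in_itv/= andbT.
  - by move=> n; have [k _] := wn n I; rewrite /= in_itv/= andbT; exists k.
apply: measurableI.
  by apply: bigcapT_measurable => k; apply: measurable_preimage => //; exact: (mX (i, k)).
apply: bigcapT_measurable => n; apply: bigcupT_measurable => k.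
by apply: measurable_preimage => //; exact: measurable_arrival.
Qed.

Lemma measurable_count_event k t : measurable (count_event k t).
Proof.
apply: (measurable_forall (F := fun i =>
  [set w | arrival i (k i) w <= t < arrival i (k i).+1 w])) => i.
have -> : [set w | arrival i (k i) w <= t < arrival i (k i).+1 w] =
  (arrival i (k i) @^-1` `]-oo, t]) `&` (arrival i (k i).+1 @^-1` `]t, +oo[).
  apply/seteqP; split=> w; rewrite /= !in_itv/= ?andbT; first by case/andP.
  by case=> -> ->.
by apply: measurableI; apply: measurable_preimage => //; exact: measurable_arrival.
Qed.

Lemma history_measurable l : history l `<=` measurable.
Proof.
apply: smallest_sub; first exact: sigma_algebra_measurable.
by move=> _ [k [t [_ ->]]]; exact: measurable_count_event.
Qed.

(** * Integer tails of waiting times and almost sure regularity of the clocks *)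

Let q : R := expR (-1).

Let q_gt0 : 0 < q. Proof. exact: expR_gt0. Qed.

Let q_le_half : 2 * q <= 1.
Proof.
have e2 : 2 <= expR 1 :> R by have := expR_ge1Dx (1 : R); lra.
by have := expRxMexpNx_1 (1 : R); rewrite -/q; have := q_gt0; nra.
Qed.

(** Tails at integers are powers of [q], so raising an integer threshold by a constant costs a fixed
    factor. *)
Lemma tail_prob p (n : nat) : P (X p @^-1` [set x | n%:R < x]) = (q ^+ n)%:E.
Proof.
case: clocks => _ law _; rewrite (exponential_tail (mX p)) ?ler0n//.
  by rewrite /q -expRM_natl mulrN1.
by move=> A mA; exact: law.
Qed.

Lemma probability_geometric_eq0 (A : set T) (r : R) : 0 <= r -> r < 1 ->
  (forall n, (P A <= (r ^+ n)%:E)%E) -> P A = 0%E.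
Proof.
move=> r0 r1 Ar; apply/eqP; rewrite eq_le measure_ge0 andbT.
have Afin : (fine (P A))%:E = P A.
  by rewrite fineK// ge0_fin_numE ?measure_ge0// (le_lt_trans (Ar 0%N)) ?ltry.
have r1' : `|r| < 1 by rewrite ger0_norm.
have cv := cvg_expr r1'.
rewrite -Afin lee_fin -(cvg_lim _ cv)//; apply: limr_ge; first exact: cvgP cv.
by apply: nearW => n; rewrite -lee_fin Afin.
Qed.

Let measurable_gt (a : R) : measurable [set x : R | a < x].
Proof.
have -> : [set x : R | a < x] = `]a, +oo[%classic; last by [].
by apply/seteqP; split=> x; rewrite /= in_itv/= andbT.
Qed.

Let mtail p (B : set R) : measurable B -> measurable (X p @^-1` B).
Proof. by move=> mB; exact: measurable_preimage. Qed.

(** For each [n], the first [n] of these waiting times are all at most 1 with probability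
    [(1 - q) ^+ n]. *)
Lemma all_short_prob0 i M :
  P (\bigcap_(m in [set m | (M <= m)%N]) (tau i m @^-1` ~` [set x | 1 < x])) = 0%E.
Proof.
have mB : measurable (~` [set x : R | 1 < x]) by exact: measurableC.
apply: (@probability_geometric_eq0 _ (1 - q)) => [||n]; rewrite ?subr_ge0 ?ltrBlDr ?ltrDl//.
  by have := q_le_half; lra.
pose F := [seq (i, m) | m <- iota M n].
apply: (@le_trans _ _ (P (cylinder X F (fun=> ~` [set x | 1 < x])))).
  apply: le_measure; rewrite ?inE.
  - by apply: bigcap_measurableType => m _; exact: (mtail (i, m)).
  - exact: measurable_cylinder.
  - by move=> w wM _ /mapP[m + ->]; rewrite mem_iota => /andP[Mm _]; exact: wM.
rewrite /cylinder indep//; last first.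
  by rewrite map_inj_uniq ?iota_uniq// => m m' [].
rewrite big_map; under eq_bigr => m _.
  rewrite -preimage_setC probability_setC; last exact: mtail.
  rewrite (tail_prob (i, m) 1) expr1; over.
rewrite -EFinB -(big_morph EFin EFinM (erefl _)) big_const_seq count_predT size_iota.
by rewrite lee_fin iter_mulr_1.
Qed.

Lemma good_prob : P (~` good) = 0%E.
Proof.
have mngood : measurable (~` good) by apply: measurableC; exact: measurable_good.
apply: measure_negligible => //.
pose short i M := \bigcap_(m in [set m | (M <= m)%N]) (tau i m @^-1` ~` [set x | 1 < x]).
(* Outside [good], either some waiting time is not positive, or those of some agent are at most 1
   from some index on: countably many null events. *)
pose N (p : V * nat) := (X p @^-1` ~` [set x | 0 < x]) `|` short p.1 p.2.
apply: (negligibleS (A := \bigcup_n if unpickle n is Some p then N p else set0)).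
  move=> w; apply: contra_notP => wN.
  have {wN}wN p : ~ N p w by move=> Np; apply: wN; exists (pickle p) => //; rewrite pickleK.
  move=> i; have tau0 k : 0 < tau i k w.
    by apply: contra_notP (wN (i, k)) => ?; left.
  (* A later waiting time above 1 carries the arrival times past the next integer. *)
  split=> // n; elim: n => [|n [k nk]].
    by exists 1%N; rewrite arrivalS arrival0 add0r.
  have [m km tau1] : exists2 m, (k <= m)%N & 1 < tau i m w.
    apply: contra_notP (wN (i, k)) => /forall2NP km; right => m /= km' tau1.
    by case: (km m).
  exists m.+1; rewrite arrivalS -natr1 ltrD// (lt_le_trans nk)//.
  elim: m km {tau1} => [|m IH]; first by rewrite leqn0 => /eqP ->.
  rewrite leq_eqVlt => /predU1P[-> //|/IH/le_trans]; apply.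
  by rewrite arrivalS lerDl ltW.
apply: negligible_bigcup => n; case: (unpickle n) => [[i k]|]; last exact: negligible_set0.
apply: negligibleU; apply/negligibleP.
- by apply: mtail; exact: measurableC.
- suff : P (X (i, k) @^-1` ~` [set x | 0 < x]) = 0%E by [].
  rewrite -preimage_setC probability_setC; last exact: mtail.
  by rewrite (tail_prob (i, k) 0) expr0 subee.
- apply: bigcap_measurableType => m _; apply: (mtail (i, m)); exact: measurableC.
- exact: all_short_prob0.
Qed.

(** * Cells of rounded elapsed times, and the conditional bound for one slot *)

Definition cell (l : nat) (k z : V -> nat) : set T :=
  [set w | [/\ good w, count_event k l.*2%:R w &
    forall j, (z j)%:R <= l.*2%:R - arrival j (k j) w < (z j).+1%:R]].

Lemma measurable_cell l k z : measurable (cell l k z).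
Proof.
pose F j := arrival j (k j) @^-1` `]l.*2%:R - (z j).+1%:R, l.*2%:R - (z j)%:R].
have -> : cell l k z =
    good `&` (count_event k l.*2%:R `&` [set w | forall j, F j w]).
  by apply/seteqP; split=> w; [move=> [? ? zw]|move=> [? [? zw]]];
    do !split => //; move=> j; have := zw j; rewrite /F /= in_itv/=; lra.
apply: measurableI; first exact: measurable_good.
apply: measurableI; first exact: measurable_count_event.
apply: measurable_forall => j; apply: measurable_preimage => //.
exact: measurable_arrival.
Qed.

Lemma counts_inj k k' t w : good w ->
  count_event k t w -> count_event k' t w -> k =1 k'.
Proof.
move=> gw kw k'w j; have /andP[] := kw j; have /andP[] := k'w j.
move=> a b c e; have := le_lt_trans a e; have := le_lt_trans c b.
rewrite !ltNge !good_arrival_le// -!ltnNge !ltnS => kk' k'k.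
by apply/eqP; rewrite eqn_leq kk' k'k.
Qed.

Lemma trivIset_cell l : trivIset setT
  (fun kz : {ffun V -> nat} * {ffun V -> nat} => cell l kz.1 kz.2).
Proof.
move=> [k z] [k' z'] _ _ [w [/= [gw kw zw] [_ k'w z'w]]].
have kk' : k = k' by apply/ffunP; exact: counts_inj kw k'w.
subst k'; congr (_, _); apply/ffunP => j.
have /andP[a b] := zw j; have /andP[c e] := z'w j.
have := le_lt_trans a e; have := le_lt_trans c b; rewrite !ltr_nat !ltnS => zz' z'z.
by apply/eqP; rewrite eqn_leq zz' z'z.
Qed.

(** The count of [j] is one less than the index of its first arrival after [2l]; that index is
    positive as [arrival j 0] is 0. *)
Lemma good_cell l w : good w ->
  exists kz : {ffun V -> nat} * {ffun V -> nat}, cell l kz.1 kz.2 w.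
Proof.
move=> gw; pose t : R := l.*2%:R.
have /choice[k kP] j : exists m, arrival j m w <= t < arrival j m.+1 w.
  have [m tm m_min] := ex_minnP (good_arrival_unbounded gw j t).
  case: m tm m_min => [|m] tm m_min; first by rewrite arrival0 ltNge ler0n in tm.
  by exists m; rewrite tm andbT leNgt; apply/negP => /m_min; rewrite ltnn.
exists ([ffun j => k j], [ffun j => Num.truncn (t - arrival j (k j) w)]).
split=> // j; rewrite !ffunE; first exact: kP.
by apply: truncn_itv; rewrite subr_ge0; have /andP[] := kP j.
Qed.

(** The waiting times still running at time [2l] when the counts are [k]. *)
Let now (k : V -> nat) : seq (V * nat) := [seq (j, k j) | j <- enum V].

Let now_gt (z : V -> nat) (p : V * nat) : set R := [set x | (z p.1)%:R < x].

(* If agent j was last seen ticking z_j to z_j + 1 time units ago, these waiting times make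
   agent i tick exactly once, and every other agent not at all, in the next 2 time units. *)
Let next (k z : V -> nat) (i : V) (p : V * nat) : set R :=
  if p == (i, (k i).+1) then [set x | 2%:R < x]
  else if p.1 == i then [set x | (z p.1).+1%:R < x] `\` [set x | (z p.1).+2%:R < x]
  else [set x | (z p.1).+3%:R < x].

Let measurable_next k z i p : measurable (next k z i p).
Proof. by rewrite /next; do 2?case: ifP => _ //; exact: measurableD. Qed.

Lemma now_prob k z :
  (\prod_(p <- now k) P (X p @^-1` now_gt z p))%E = (\prod_j q ^+ z j)%:E.
Proof.
rewrite (big_morph EFin EFinM (erefl _)) big_map big_enum.
by apply: eq_bigr => j _; exact: (tail_prob (j, k j)).
Qed.

Lemma between_prob p n :
  P (X p @^-1` ([set x | n%:R < x] `\` [set x | n.+1%:R < x])) =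
  (q ^+ n - q ^+ n.+1)%:E.
Proof.
pose G m : set R := [set x | m%:R < x].
have mG m : measurable (X p @^-1` G m) by apply: mtail; exact: measurable_gt.
have -> : P (X p @^-1` (G n `\` G n.+1)) =
    (P (X p @^-1` G n) - P (X p @^-1` G n `&` X p @^-1` G n.+1))%E.
  apply: measureD; [exact: mG|exact: mG|]; suff : (P (X p @^-1` G n) < +oo)%E by [].
  by rewrite tail_prob ltry.
rewrite setIidr; last by move=> w /=; apply: lt_trans; rewrite ltr_nat.
by rewrite !tail_prob.
Qed.

(** Relative to [now_prob], agent [i] pays [q * (1 - q) >= q ^+ 3], every other agent pays [q ^+ 3],
    and the second waiting time of [i] costs [q ^+ 2]. *)
Lemma next_prob k z i :
  ((q ^+ (3 * #|V|).+2 * \prod_j q ^+ z j)%:E <=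
   \prod_(p <- (i, (k i).+1) :: now k) P (X p @^-1` next k z i p))%E.
Proof.
pose f j := if j == i then q ^+ (z j).+1 - q ^+ (z j).+2 else q ^+ (z j).+3.
have -> : (\prod_(p <- (i, (k i).+1) :: now k) P (X p @^-1` next k z i p) =
    (q ^+ 2 * \prod_j f j)%:E)%E.
  rewrite big_cons EFinM; congr (_ * _)%E.
    by rewrite /next eqxx; exact: (tail_prob (_, _) 2).
  rewrite (big_morph EFin EFinM (erefl _)) big_map big_enum.
  apply: eq_bigr => j _; rewrite /next /f /= xpair_eqE.
  case: eqVneq => [->|ji] /=; last exact: (tail_prob (_, _)).
  by rewrite (ltn_eqF (ltnSn _)); exact: (between_prob (_, _)).
rewrite lee_fin -add2n exprD -mulrA ler_wpM2l ?exprn_ge0 ?(ltW q_gt0)//.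
have -> : q ^+ (3 * #|V|) = \prod_(j : V) q ^+ 3 by rewrite prodr_const exprM.
rewrite -big_split; apply: ler_prod => j _ /=.
rewrite mulr_ge0 ?exprn_ge0 ?(ltW q_gt0)//= /f.
case: ifP => _; last by rewrite -exprD.
rewrite !exprS !mulrA -mulrBl ler_wpM2r ?exprn_ge0 ?(ltW q_gt0)//.
by have := q_gt0; have := q_le_half; nra.
Qed.

(** On each cell, [A] lies in [B'] cut by the rectangle [now_gt], while [B'] cut by the rectangle
    [next] lies, up to a null set, in the slot event. Both rectangles are independent of [B']. *)
Lemma slot_prob l i A : history l A ->
  ((q ^+ (3 * #|V|).+2)%:E * P A <= P (A `&` slot_event l i))%E.
Proof.
move=> hA; have mA := history_measurable hA.
have mS : measurable (slot_event l i) by apply: history_measurable; exact: history_slot.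
apply: (probability_le_cover (Q := fun kz : {ffun V -> nat} * {ffun V -> nat} =>
  cell l kz.1 kz.2)) => //.
- by rewrite exprn_ge0// ltW.
- exact: measurableI.
- by move=> kz; exact: measurable_cell.
- exact: trivIset_cell.
- apply/eqP; rewrite eq_le measure_ge0 andbT -good_prob.
  apply: le_measure; rewrite ?inE.
  + apply: measurableC; apply: countable_bigcupT_measurable => [|kz]; first exact: countableP.
    exact: measurable_cell.
  + by apply: measurableC; exact: measurable_good.
  + by move=> w; apply: contra_not => /(good_cell l)[kz]; exists kz.
move=> [k z] /=.
have [B pB AB] := history_past k hA.
pose t : R := l.*2%:R.
pose F j := arrival j (k j) @^-1` `]t - (z j).+1%:R, t - (z j)%:R].
(* Rounded elapsed times depend on seen waiting times only, so they can join [B] in the past. *)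
pose B' := B `&` [set w | forall j, F j w].
have pB' : past k B'.
  apply: (@measurableI _ (pastT k)) => //.
  by apply: past_forall => j; apply: past_preimage.
have FP w : (forall j, F j w) <->
    (forall j, (z j)%:R <= t - arrival j (k j) w < (z j).+1%:R).
  by split=> Fw j; have := Fw j; rewrite /F /= in_itv/=; lra.
have uniq_next : uniq (seen k ++ (i, (k i).+1) :: now k).
  rewrite cat_uniq uniq_seen /= map_inj_uniq ?enum_uniq; last by move=> ? ? [].
  rewrite andbT negb_or mem_seen -leqNgt leqnSn /=; apply/andP; split.
    by apply/hasPn => _ /mapP[j _ ->]; rewrite mem_seen ltnn.
  by apply/negP => /mapP[j _ [<- /eqP]]; rewrite gtn_eqF.
have uniq_now : uniq (seen k ++ now k).
  move: uniq_next; rewrite -[_ :: _]cat1s uniq_catCA cat_uniq.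
  by case/and3P.
have mnow p : measurable (now_gt z p) by exact: measurable_gt.
apply: (@le_trans _ _ ((q ^+ (3 * #|V|).+2)%:E * P (B' `&` cylinder X (now k) (now_gt z)))%E).
  apply: lee_pmul => //; first by rewrite lee_fin exprn_ge0// ltW.
  apply: le_measure; rewrite ?inE.
  - by apply: measurableI => //; exact: measurable_cell.
  - by apply: measurableI; [exact: past_measurable pB'|exact: measurable_cylinder].
  move=> w [Aw [gw kw zw]]; split; first by split; [exact/(AB w kw gw)|exact/FP].
  move=> _ /mapP[j _ ->]; rewrite /now_gt /X /=.
  by have /andP[_] := kw j; have /andP[+ _] := zw j; rewrite arrivalS; lra.
apply: (@le_trans _ _ (P ((B' `&` cylinder X ((i, (k i).+1) :: now k) (next k z i)) `&` good))).
  rewrite (probability_setI_full _ measurable_good good_prob); last first.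
    by apply: measurableI; [exact: past_measurable pB'|exact: measurable_cylinder].
  rewrite !(indep_cylinder mX indep _ _ pB')// now_prob muleCA.
  by apply: lee_wpmul2l => //; rewrite -EFinM; exact: next_prob.
apply: le_measure; rewrite ?inE.
- apply: measurableI; last exact: measurable_good.
  by apply: measurableI; [exact: past_measurable pB'|exact: measurable_cylinder].
- by apply: measurableI; [exact: measurableI|exact: measurable_cell].
move=> w [[[Bw /FP zw] wnext] gw].
have tau_i2 : 2%:R < tau i (k i).+1 w.
  by have := wnext (i, (k i).+1); rewrite /next /= eqxx; apply; rewrite inE eqxx.
have tau_i : (z i).+1%:R < tau i (k i) w <= (z i).+2%:R.
  have := wnext (i, k i); rewrite /next /= xpair_eqE (ltn_eqF (ltnSn _)) andbF eqxx.
  rewrite inE map_f ?mem_enum// orbT => /(_ isT)[/= -> /negP].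
  by rewrite -leNgt.
have tau_j j : j != i -> (z j).+3%:R < tau j (k j) w.
  move=> ji; have := wnext (j, k j); rewrite /next /= xpair_eqE (negbTE ji) /=.
  by apply; rewrite inE map_f ?mem_enum// orbT.
(* Elapsed times lie in [[z, z + 1)]: a waiting time in [(z + 1, z + 2]] has between 0 and 2 left to
   run, and one above [z + 3] has more than 2 left. *)
have kw : count_event k t w.
  move=> j /=; rewrite arrivalS; have := zw j; rewrite -[in X in X -> _]natr1.
  have [->|ji] := eqVneq j i.
    by move: tau_i; rewrite -natr1; have := ler0n R (z i); lra.
  by have := tau_j j ji; rewrite -!natr1; have := ler0n R (z j); lra.
do 2!split => //; [exact/(AB w kw gw)|].
exists k; split => // j; rewrite doubleS -!natr1 -/t.
have [->|ji] /= := eqVneq j i.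
  rewrite addn1 !arrivalS; have := zw i; move: tau_i tau_i2; rewrite -!natr1.
  by have := ler0n R (z i); lra.
rewrite addn0 arrivalS; have := zw j; have := tau_j j ji; have := kw j; rewrite -!natr1.
by have := ler0n R (z j); rewrite -/t; lra.
Qed.

(** * Almost sure occurrence of a given word *)

Let c : R := q ^+ (3 * #|V|).+2.

Let c_gt0 : 0 < c. Proof. by rewrite exprn_gt0. Qed.

Let c_le1 : c <= 1.
Proof. by rewrite exprn_ile1 ?ltW//; have := q_gt0; have := q_le_half; lra. Qed.

(** Cutting [A] by a slot event gives an event of the next history, so the bound for one slot
    iterates. *)
Lemma slots_prob l u A : history l A ->
  ((c ^+ size u)%:E * P A <= P (A `&` slots_event l u))%E.
Proof.
elim: u l A => [|i u IH] l A hA.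
  by rewrite expr0 mul1e (_ : slots_event l [::] = setT)// setIT.
have hAi : history l.+1 (A `&` slot_event l i).
  by apply: history_setI; [exact: (history_le (leqnSn l))|exact: history_slot].
have -> : A `&` slots_event l (i :: u) =
  (A `&` slot_event l i) `&` slots_event l.+1 u by rewrite -setIA.
apply: le_trans (IH _ _ hAi); rewrite /= exprSr EFinM -muleA.
apply: lee_wpmul2l; first by rewrite lee_fin exprn_ge0// ltW.
exact: slot_prob.
Qed.

Lemma slots_ae u : {ae P, forall w, exists l, slots_event l u w}.
Proof.
pose W m := slots_event (m * size u) u.
(* The first [n] disjoint blocks all miss [u]. This is known when block [n] starts, so each further
   block multiplies the probability by at most [1 - c ^+ size u]. *)
pose never n := \big[setI/setT]_(m < n) ~` W m.
have hnever n : history (n * size u) (never n).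
  rewrite /never; elim: n => [|n IH].
    by rewrite big_ord0; exact: (@measurableT _ (historyT _)).
  rewrite big_ord_recr /= mulSn addnC; apply: history_setI.
    by apply: history_le IH; rewrite leq_addr.
  by apply: history_setC; exact: history_slots.
have mnever n : measurable (never n) by exact: history_measurable (hnever n).
have mW n : measurable (W n).
  by apply: history_measurable; exact: history_slots.
exists (\bigcap_n ~` W n); split.
- by apply: bigcapT_measurable => n; exact: measurableC.
- apply: (@probability_geometric_eq0 _ (1 - c ^+ size u)).
  + by rewrite subr_ge0 exprn_ile1// ltW.
  + by rewrite ltrBlDr ltrDl exprn_gt0.
  move=> n; apply: (@le_trans _ _ (P (never n))).
    apply: le_measure; rewrite ?inE//.
      by apply: bigcapT_measurable => m; exact: measurableC.
    move=> w wW; rewrite /never; elim/big_ind: _ => // m _; exact: wW.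
  elim: n => [|n IH]; first by rewrite expr0 probability_le1.
  have := slots_prob u (hnever n).
  rewrite [never n.+1]big_ord_recr /= -/(never n) -setDE.
  have -> : P (never n `\` W n) = (P (never n) - P (never n `&` W n))%E.
    apply: measureD => //; suff : (P (never n) < +oo)%E by [].
    by rewrite ltey_eq fin_num_measure.
  have fin A : measurable A -> P A = (fine (P A))%:E.
    by move=> mA; rewrite fineK// fin_num_measure.
  move: IH; rewrite (fin _ (mnever n)) (fin _ (measurableI _ _ (mnever n) (mW n))).
  rewrite -EFinM -EFinB !lee_fin exprS => IH lb.
  apply: (@le_trans _ _ ((1 - c ^+ size u) * fine (P (never n)))).
    by rewrite mulrBl mul1r lerD2l lerN2.
  by rewrite ler_wpM2l// subr_ge0 exprn_ile1// ltW.
- by move=> w /= wl n _ Wn; apply: wl; exists (n * size u)%N.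
Qed.

Lemma good_ae : {ae P, forall w, good w}.
Proof.
by exists (~` good); split=> //; [exact: measurableC measurable_good|exact: good_prob].
Qed.

End Clocks.

Theorem theorem2 (R : realType) (V : finType) (W : V -> V -> R) (h : V -> R)
    (d : measure_display) (T : measurableType d) (P : probability T R)
    (tau : V -> nat -> T -> R) (x0 : config V) (X : T -> R -> config V) :
  (forall i j, 0 <= W i j) -> (forall i, W i i = 0) ->
  poisson_clocks P tau ->
  {ae P, forall w, ltd_path W h (ticks tau w) x0 (X w)} ->
  {ae P, forall w, exists t0, 0 <= t0 /\
     forall t, t0 <= t -> is_equilibrium W h (X w t)}.
Proof.
move=> W_ge0 W_diag clocks.
have [u u_eq] := universal_word h W_ge0 W_diag.
(* The rest is pathwise, on the intersection of three almost sure events. *)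
apply: filterS3 (good_ae clocks) (slots_ae clocks u) => w gw [l wl] wP.
have mono := good_arrival_mono gw.
have Xu := slots_run mono wP wl.
(* The end of the slots that spell [u]. *)
exists (l + size u).*2%:R; split=> [|t t0t]; first exact: ler0n.
have X_eq : is_equilibrium W h (X w (l + size u).*2%:R) by rewrite Xu; exact: u_eq.
rewrite (equilibrium_absorbing mono wP W_diag (good_arrival_unbounded gw) _ X_eq)//.
Qed.
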